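(* Let $B=[b_1,\ldots,b_n]\in\mathbb{C}[x_1,\ldots,x_m]^n$, let $\mathbf{z}_s=[z_{s,1},\ldots,z_{s,m}]\in\mathbb{C}^m$ for $s=1,\ldots,k$, and let $$C_i=\{[z_{i,1}+\delta_{i,1,1}\varepsilon,\ldots,z_{i,m}+\delta_{i,1,m}\varepsilon],\ldots,[z_{i,1}+\delta_{i,n_i,1}\varepsilon,\ldots,z_{i,m}+\delta_{i,n_i,m}\varepsilon]\},\qquad i=1,\ldots,k,$$ be clusters with $\sum_{i=1}^kn_i=n$, where $\varepsilon$ is a parameter and $\delta_{i,j,r}\in\mathbb{C}$ with $|\delta_{i,j,r}|<1$ for all $i,j,r$. Let $R$ be the matrix of traces associated to $C_1\cup\cdots\cup C_k$ and $B$. Let $P$ be the (row) permutation matrix, with permutation $\sigma$, produced by $k$ steps of Gaussian elimination with complete pivoting on $R$, where $B$ is ordered so that the column permutation is the identity, and assume that $P\,R|_{\varepsilon=0}$ has rank $k$ and is regular. For $s=1,\ldots,k$ let $\vec{\xi}_s=[\xi_{s,1},\ldots,\xi_{s,m}]$ be defined by $$\xi_{s,i}:=z_{s,i}+\frac{\sum_{r=1}^{n_s}\delta_{s,r,i}}{n_s}\,\varepsilon,\qquad i=1,\ldots,m.$$ Then $\vec{\xi}_1,\ldots,\vec{\xi}_k$ satisfy modulo $\varepsilon^2$ the defining equations $\{f_{i,j}\}$ of the approximate radical ideal of $C_1\cup\cdots\cup C_k$ (defined in the context); that is, $f_{i,j}(\vec{\xi}_s)\equiv0\mod\varepsilon^2$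 in $\mathbb{C}[[\varepsilon]]$ for all $i=1,\ldots,m$, $j=1,\ldots,k$, $s=1,\ldots,k$.
   Context: Write $\vec{\delta}_{s,t}=[\delta_{s,t,1},\ldots,\delta_{s,t,m}]$. For a polynomial $g\in\mathbb{C}[x_1,\ldots,x_m]$ put $Tr(g):=\sum_{s=1}^k\sum_{t=1}^{n_s}g(\mathbf{z}_s+\vec{\delta}_{s,t}\varepsilon)\in\mathbb{C}[\varepsilon]$ (the trace of multiplication by $g$ for the points of the clusters). The matrix of traces associated to $C_1\cup\cdots\cup C_k$ and $B$ is $R=[Tr(b_ib_j)]_{i,j=1}^n$. Regular Gaussian elimination always uses the $(i,i)$ entry as pivot at step $i$. A matrix $M$ is regular if, for $r:=\mathrm{rank}(M)$, the first $r$ steps of regular Gaussian elimination on $M$ do not encounter zero pivots. Gaussian elimination with complete pivoting (GECP): at step $i$, rows and columns of index $\geq i$ are permuted so that the $(i,i)$ entry of the current matrix has maximal absolute value among the entries with both indices $\geq i$ (for $R$, absolute values are compared for sufficiently small $\varepsilon>0$). The permutation matrices $P,Q$ it produces are such that regular Gaussian elimination on $P\,R\,Q$ works as GECP; by renaming the elements of $B$ one assumes $Q=\mathrm{id}$. Put $\tilde R:=P\,R$, whose rows and columns correspond to $[b_{\sigma(1)},\ldots,b_{\sigma(n)}]$ and $[b_1,\ldots,b_n]$, i.e. $\tilde R_{s,t}=Tr(b_{\sigma(s)}b_t)$. Let $\tilde R^{(k)}$ be the $k\times k$ principal (top left) submatrix of $\tilde R$. For $i=1,\ldots,m$, $j=1,\ldots,k$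 let $\mathbf{r}_{i,j}:=[Tr(x_ib_jb_{\sigma(1)}),\ldots,Tr(x_ib_jb_{\sigma(k)})]^T$ and let $\mathbf{v}_{i,j}\in\mathbb{C}(\varepsilon)^k$ be the solution of the linear system $\tilde R^{(k)}\mathbf{v}_{i,j}=\mathbf{r}_{i,j}$. Define $$f_{i,j}:=x_ib_j-\sum_{s=1}^k[\mathbf{v}_{i,j}]_s\,b_s .$$ The approximate radical ideal of the clusters is $\widetilde{\sqrt I}:=\langle f_{i,j}: i=1,\ldots,m,\ j=1,\ldots,k\rangle$. The coordinates of the $\mathbf{v}_{i,j}$ are rational functions of $\varepsilon$ with denominators nonzero at $\varepsilon=0$ and are identified with their Taylor expansions in $\mathbb{C}[[\varepsilon]]$. *)

(* Defs.v *)
From HB Require Import structures.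
From mathcomp Require Import all_boot all_order all_algebra all_fingroup.
From mathcomp Require Import reals complex.
From mathcomp Require Import mpoly.
Set Implicit Arguments.
Unset Strict Implicit.
Unset Printing Implicit Defensive.
Import Order.TTheory GRing.Theory Num.Theory.
Local Open Scope ring_scope.
Local Open Scope complex_scope.

(* The variable 'X of {poly R[i]} is the parameter epsilon. *)
Notation epspoly R := {poly R[i]}.
Notation epsfrac R := {fraction {poly R[i]}}.

(** * Rational functions of epsilon *)

(* The chosen denominator may vanish at e, where the result is then junk; it
   is a nonzero polynomial, so this does not happen for small e > 0. *)
Definition evalfrac (R : realType) (f : epsfrac R) (e : R) : R[i] :=
  (\n_(generic_quotient.repr f)).[e%:C] / (\d_(generic_quotient.repr f)).[e%:C].

Definition le_small_eps (R : realType) (f g : epsfrac R) : Prop :=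
  exists2 d : R, 0 < d &
    forall e : R, 0 < e -> e < d -> `|evalfrac f e| <= `|evalfrac g e|.

(* [a] is the coefficient sequence of the Taylor expansion of [f] at 0: f = p/q
   with q(0) != 0, and p = q * a as formal power series.  In particular [f] has
   such an expansion iff it can be written with a denominator nonzero at 0. *)
Definition is_taylor (R : realType) (f : epsfrac R) (a : nat -> R[i]) : Prop :=
  exists p q : epspoly R,
    [/\ q.[0] != 0, f = tofrac p / tofrac q &
        forall l : nat, p`_l = \sum_(i < l.+1) q`_i * a (l - i)%N].

(* [f] is identified with an element of C[[eps]][x_1..x_m] through the Taylor
   expansions of its coefficients, and f(xi) = 0 mod eps^2 in C[[eps]]. *)
Definition vanishes_mod_eps2 (R : realType) (m : nat)
    (f : {mpoly (epsfrac R)[m]}) (xi : 'I_m -> epspoly R) : Prop :=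
  (forall mon : 'X_{1..m}, exists a, is_taylor f@_mon a) /\
  (exists a, [/\ is_taylor f.@[fun i => tofrac (xi i)] a, a 0%N = 0 & a 1%N = 0]).

(** * Gaussian elimination *)

(* Elimination below the pivot (i, i); a zero pivot leaves the matrix as is. *)
Definition elim_step (F : fieldType) (n : nat) (A : 'M[F]_n) (i : 'I_n)
    : 'M[F]_n :=
  \matrix_(r, c) if (i < r)%N then A r c - A r i / A i i * A i c else A r c.

(* The matrix obtained after r steps of regular Gaussian elimination. *)
Definition gauss (F : fieldType) (n : nat) (A : 'M[F]_n) (r : nat) : 'M[F]_n :=
  foldl (@elim_step F n) A (take r (enum 'I_n)).

Definition regular_mx (F : fieldType) (n : nat) (M : 'M[F]_n) : Prop :=
  forall i : 'I_n, (i < \rank M)%N -> gauss M i i i != 0.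

(* [gecp A l sigma tau M]: l steps of Gaussian elimination with complete
   pivoting on A can lead to the matrix M, with accumulated row and column
   permutations sigma and tau, i.e. the permuted input matrix has entries
   A (sigma i) (tau j).  Several outcomes are possible because of ties. *)
Inductive gecp (R : realType) (n : nat) (A : 'M[epsfrac R]_n) :
    nat -> 'S_n -> 'S_n -> 'M[epsfrac R]_n -> Prop :=
| GecpStart : gecp A 0%N 1%g 1%g A
| GecpStep (i : 'I_n) (sigma tau s t : 'S_n) (M : 'M[epsfrac R]_n) :
    gecp A i sigma tau M ->
    perm_on [set r : 'I_n | (i <= r)%N] s ->
    perm_on [set c : 'I_n | (i <= c)%N] t ->
    let M' := row_perm s (col_perm t M) in
    (forall r c : 'I_n, (i <= r)%N -> (i <= c)%N -> le_small_eps (M' r c) (M' i i)) ->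
    gecp A i.+1 (s * sigma)%g (t * tau)%g (elim_step M' i).

(** * Clusters, traces and the approximate radical ideal *)

Lemma leq_clusters (k n : nat) (ns : 'I_k -> nat) :
  (forall s, 0 < ns s)%N -> (\sum_(s < k) ns s)%N = n -> (k <= n)%N.
Proof.
move=> ns_gt0 <-; rewrite -[X in (X <= _)%N]card_ord -sum1_card.
by apply: leq_sum => s _; exact: ns_gt0.
Qed.

Section Clusters.
Variables (R : realType) (m k : nat) (ns : 'I_k -> nat).
Variables (z : 'I_k -> 'I_m -> R[i]).
Variables (delta : forall s : 'I_k, 'I_(ns s) -> 'I_m -> R[i]).

Definition cluster_pt (s : 'I_k) (t : 'I_(ns s)) (i : 'I_m) : epspoly R :=
  (z s i)%:P + (delta t i)%:P * 'X.

Definition cluster_center (s : 'I_k) (i : 'I_m) : epspoly R :=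
  (z s i)%:P + ((\sum_(r < ns s) delta r i) / (ns s)%:R)%:P * 'X.

Definition Tr (g : {mpoly R[i][m]}) : epspoly R :=
  \sum_(s < k) \sum_(t < ns s) (map_mpoly polyC g).@[cluster_pt t].

Variables (n : nat) (b : 'I_n -> {mpoly R[i][m]}).

Definition trace_mx : 'M[epspoly R]_n := \matrix_(i, j) Tr (b i * b j).

Variables (le_kn : (k <= n)%N) (sigma : 'S_n).
Let w (j : 'I_k) : 'I_n := widen_ord le_kn j.

Definition trace_mx_k : 'M[epspoly R]_k :=
  \matrix_(s, t) (perm_mx sigma *m trace_mx) (w s) (w t).

Definition rhs_vec (i : 'I_m) (j : 'I_k) : 'cV[epspoly R]_k :=
  \col_s Tr ('X_i * b (w j) * b (sigma (w s))).

Definition mpoly_frac (g : {mpoly R[i][m]}) : {mpoly (epsfrac R)[m]} :=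
  map_mpoly (@tofrac _ \o polyC) g.

Definition radical_gen (v : 'I_m -> 'I_k -> 'cV[epsfrac R]_k)
    (i : 'I_m) (j : 'I_k) : {mpoly (epsfrac R)[m]} :=
  'X_i * mpoly_frac (b (w j)) - \sum_(s < k) v i j s 0 *: mpoly_frac (b (w s)).

End Clusters.

(* Main.v *)
(** To first order in epsilon, a cluster only contributes through its barycentre:
    [Tr g = \sum_s n_s g(xi_s)] modulo [eps^2].  Hence, modulo [eps^2], the
    leading block of the permuted trace matrix factors as [U V], where [V] is the
    matrix of values [b_a(xi_s)], and the right-hand side as [U y], where
    [y_s = (x_i b_j)(xi_s)].  Regularity makes the block, hence [U],
    invertible at [eps = 0], so [U (V v - y) = 0] gives [V v = y] modulo [eps^2],
    which says that [f_ij] vanishes at every [xi_s] to first order.  Working with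
    [det * v = adj * r] (Cramer) keeps the computation in C[eps], the common
    denominator [det] being nonzero at 0. *)

Require Import Defs.
From HB Require Import structures.
From mathcomp Require Import all_boot all_order all_algebra all_fingroup.
From mathcomp Require Import reals complex.
From mathcomp Require Import mpoly.
From mathcomp Require Import ring.
Set Implicit Arguments.
Unset Strict Implicit.
Unset Printing Implicit Defensive.
Import Order.TTheory GRing.Theory Num.Theory.
Local Open Scope ring_scope.
Local Open Scope complex_scope.

(** * Gaussian elimination: nonzero pivots and the leading block *)

Lemma gaussS (F : fieldType) (n : nat) (A : 'M[F]_n) (i : 'I_n) :
  gauss A i.+1 = elim_step (gauss A i) i.
Proof.
rewrite /gauss (take_nth i) ?size_enum_ord // nth_ord_enum.
by rewrite -cats1 foldl_cat.
Qed.

(** A step is left multiplication by a unipotent lower triangular matrix. For a zero pivot,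
    [x / 0 = 0] makes [u] vanish and the step trivial. *)
Lemma det_elim_step (F : fieldType) (n : nat) (A : 'M[F]_n) (i : 'I_n) :
  \det (elim_step A i) = \det A.
Proof.
pose u : 'cV[F]_n := \col_r (if (i < r)%N then A r i / A i i else 0).
have -> : elim_step A i = (1%:M - u *m delta_mx 0 i) *m A.
  apply/matrixP => r c; rewrite mulmxBl mul1mx -mulmxA -rowE !mxE big_ord1 !mxE.
  by case: ifP => //; rewrite mul0r subr0.
rewrite det_mulmx det_trig ?big1 ?mul1r //.
  move=> r _; rewrite !mxE eqxx big_ord1 !mxE eqxx /=.
  by case: eqVneq => [->|_]; rewrite ?ltnn ?mul0r ?mulr0 subr0.
apply/is_trig_mxP => r c r_lt_c; rewrite !mxE big_ord1 !mxE eqxx /=.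
rewrite -val_eqE ltn_eqF //=; case: eqVneq => [<-|_]; last by rewrite mulr0 subr0.
by rewrite ltnNge (ltnW r_lt_c) mul0r subr0.
Qed.

(** Elimination preserves the determinant and ends in an upper triangular matrix whose diagonal
    consists of the pivots. *)
Lemma gauss_pivots_unitmx (F : fieldType) (n : nat) (A : 'M[F]_n) :
  (forall i : 'I_n, gauss A i i i != 0) -> A \in unitmx.
Proof.
move=> piv.
have invariant j : (j <= n)%N ->
    [/\ \det (gauss A j) = \det A,
        forall r c : 'I_n, (c < j)%N -> (c < r)%N -> gauss A j r c = 0
      & forall r : 'I_n, (r < j)%N -> gauss A j r r != 0].
  elim: j => [_|j IHj j_lt_n]; first by rewrite /gauss take0.
  have [det_j upper_j diag_j] := IHj (ltnW j_lt_n).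
  rewrite -[j]/(val (Ordinal j_lt_n)) gaussS; set i := Ordinal _.
  split.
  - by rewrite det_elim_step.
  - move=> r c; rewrite ltnS leq_eqVlt => /orP[/eqP/val_inj->|c_lt_i] c_lt_r.
      by rewrite mxE c_lt_r divfK ?subrr // piv.
    rewrite mxE (upper_j r c) // (upper_j i c) //.
    by rewrite mulr0 subr0 if_same.
  (* Step [i] leaves the rows [r <= i] untouched: row [i] still carries its pivot, earlier rows keep
     theirs. *)
  - move=> r; rewrite mxE ltnS => r_le_i; rewrite ltnNge r_le_i /=.
    move: r_le_i; rewrite leq_eqVlt => /orP[/eqP/val_inj->|]; first exact: (piv i).
    exact: diag_j.
have [det_gauss upper diag] := invariant n (leqnn n).
rewrite unitmxE unitfE -det_gauss -det_tr det_trig.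
  by apply/prodf_neq0 => r _; rewrite mxE diag.
by apply/is_trig_mxP => r c r_lt_c; rewrite mxE upper.
Qed.

(** A step with pivot index below [k] computes an entry of the leading block from entries of that
    block only. *)
Lemma gauss_leading (F : fieldType) (n k : nat) (le_kn : (k <= n)%N)
    (A : 'M[F]_n) (r : nat) : (r <= k)%N ->
  mxsub (widen_ord le_kn) (widen_ord le_kn) (gauss A r) =
  gauss (mxsub (widen_ord le_kn) (widen_ord le_kn) A) r.
Proof.
elim: r => [_|r IHr r_lt_k]; first by rewrite /gauss !take0.
rewrite -{2}[r]/(val (Ordinal r_lt_k)) gaussS -(IHr (ltnW r_lt_k)).
rewrite -{1}[r]/(val (widen_ord le_kn (Ordinal r_lt_k))) gaussS.
by apply/matrixP => a c; rewrite !mxE.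
Qed.

(** Rank [k] makes regularity speak of the first [k] pivots, which are exactly those of the leading
    block. *)
Lemma regular_leading_unitmx (F : fieldType) (n k : nat) (le_kn : (k <= n)%N)
    (A : 'M[F]_n) : \rank A = k -> regular_mx A ->
  mxsub (widen_ord le_kn) (widen_ord le_kn) A \in unitmx.
Proof.
move=> rankA regA; apply: gauss_pivots_unitmx => i.
rewrite -gauss_leading ?(ltnW (ltn_ord i)) // mxE.
by apply: (regA (widen_ord le_kn i)); rewrite rankA /=.
Qed.

(** * Taylor expansion of fractions *)

(* The remainders [P l] satisfy [p = q * (a 0 + ... + a (l-1) X^(l-1)) + X^l * P l]. *)
Lemma power_series_quotient (F : fieldType) (p q : {poly F}) : q.[0] != 0 ->
  exists a : nat -> F, forall l, p`_l = \sum_(i < l.+1) q`_i * a (l - i)%N.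
Proof.
move=> q0.
(* The subtracted multiple of [q] cancels the constant term, so that division by ['X] is exact. *)
pose next (u : {poly F}) := (u - (u.[0] / q.[0]) *: q) %/ 'X.
pose P l := iter l next p; pose a l := (P l).[0] / q.[0].
exists a => l.
have nextK u : u = (u.[0] / q.[0]) *: q + next u * 'X.
  have X_dvd : 'X %| u - (u.[0] / q.[0]) *: q.
    rewrite -['X]subr0 -polyC0 dvdp_XsubCl /root.
    by rewrite hornerD hornerN hornerZ divfK ?subrr.
  by rewrite /next (divpK X_dvd) subrKC.
have expand j : p = q * \poly_(i < j) a i + 'X^j * P j.
  elim: j => [|j IHj]; first by rewrite poly_def big_ord0 mulr0 add0r expr0 mul1r.
  rewrite {1}IHj {1}(nextK (P j)) -/(a j) !poly_def big_ord_recr /=.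
  rewrite !mulrDr -!scalerAr exprSr (mulrC q 'X^j) (mulrC _ 'X) mulrA.
  by rewrite addrA.
rewrite (expand l.+1) coefD coefXnM ltnSn addr0 coefM.
by apply: eq_bigr => i _; rewrite coef_poly ltnS leq_subr.
Qed.

Lemma taylor_tofrac_div (R : realType) (p q : epspoly R) : q.[0] != 0 ->
  exists a, is_taylor (tofrac p / tofrac q) a.
Proof.
by move=> q0; have [a Ha] := power_series_quotient p q0; exists a, p, q.
Qed.

(** The recurrence starts with [q_0 a_0 = p_0] and [q_0 a_1 + q_1 a_0 = p_1]; here [p_0 = p_1 = 0]
    and [q_0] is nonzero. *)
Lemma taylor_tofrac_div_X2 (R : realType) (p q : epspoly R) :
  q.[0] != 0 -> 'X^2 %| p ->
  exists a, [/\ is_taylor (tofrac p / tofrac q) a, a 0%N = 0 & a 1%N = 0].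
Proof.
move=> q0 /dvdpP[u ->]; have [a Ha] := power_series_quotient (u * 'X^2) q0.
have q00 : q`_0 != 0 by rewrite -horner_coef0.
have a0 : a 0%N = 0.
  have /esym/eqP := Ha 0%N; rewrite coefMXn big_ord1 mulf_eq0 (negPf q00).
  by move/eqP.
exists a; split=> //; first by exists (u * 'X^2), q.
have /esym/eqP := Ha 1%N; rewrite coefMXn big_ord_recl big_ord1 /= a0 mulr0 addr0.
by rewrite mulf_eq0 (negPf q00) => /eqP.
Qed.

(** * Linearization of polynomials along a perturbed point *)

(** [c] and [G] are the value and the gradient of [g] at [z], fixed before the direction [d]. The
    property holds for constants and variables and survives sums and products, hence reaches every
    polynomial. *)
Lemma first_order_expansion (F : fieldType) (m : nat) (g : {mpoly F[m]})
    (z : 'I_m -> F) :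
  exists (c : F) (G : 'I_m -> F), forall d : 'I_m -> F,
    'X^2 %| (map_mpoly polyC g).@[fun i => (z i)%:P + (d i)%:P * 'X]
            - (c%:P + (\sum_i G i * d i)%:P * 'X).
Proof.
pose ev (h : {mpoly F[m]}) (d : 'I_m -> F) :=
  (map_mpoly polyC h).@[fun i => (z i)%:P + (d i)%:P * 'X].
pose good h := exists (c : F) (G : 'I_m -> F), forall d : 'I_m -> F,
    'X^2 %| ev h d - (c%:P + (\sum_i G i * d i)%:P * 'X).
have goodC c : good c%:MP.
  exists c, (fun=> 0) => d; rewrite /ev map_mpolyC ?polyC0 // mevalC.
  by rewrite big1 => [|i _]; rewrite ?mul0r // ?polyC0 ?mul0r addr0 subrr dvdp0.
have goodX i : good 'X_i.
  exists (z i), (fun l => (l == i)%:R) => d.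
  rewrite /ev map_mpolyX mevalXU (bigD1 i) //= eqxx mul1r big1 ?addr0.
    by rewrite subrr dvdp0.
  by move=> l /negPf->; rewrite mul0r.
have goodD g1 g2 : good g1 -> good g2 -> good (g1 + g2).
  move=> [c1 [G1 H1]] [c2 [G2 H2]]; exists (c1 + c2), (fun i => G1 i + G2 i) => d.
  have := dvdp_add (H1 d) (H2 d); congr (_ %| _).
  under [in RHS]eq_bigr do rewrite mulrDl.
  rewrite /ev rmorphD mevalD big_split /= !polyCD mulrDl.
  by rewrite [X in _ = _ - X]addrACA [in RHS]opprD [RHS]addrACA.
have goodM g1 g2 : good g1 -> good g2 -> good (g1 * g2).
  move=> [c1 [G1 H1]] [c2 [G2 H2]].
  (* The Leibniz rule; [product] collects the two given errors and the second-order term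
     [s1 * s2 * x ^+ 2]. *)
  exists (c1 * c2), (fun i => c1 * G2 i + c2 * G1 i) => d.
  have product (A : comPzRingType) (e1 e2 a1 a2 s1 s2 x : A) :
      (e1 - (a1 + s1 * x)) * e2 + (a1 + s1 * x) * (e2 - (a2 + s2 * x))
        + s1 * s2 * x ^+ 2 = e1 * e2 - (a1 * a2 + (a1 * s2 + a2 * s1) * x).
    by ring.
  have := dvdp_add (dvdp_add (dvdp_mulr (ev g2 d) (H1 d))
    (dvdp_mull (c1%:P + (\sum_i G1 i * d i)%:P * 'X) (H2 d)))
    (dvdp_mull ((\sum_i G1 i * d i)%:P * (\sum_i G2 i * d i)%:P) (dvdpp 'X^2)).
  rewrite product; congr (_ %| _).
  under [in RHS]eq_bigr do rewrite mulrDl -!mulrA.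
  by rewrite /ev rmorphM mevalM big_split /= -!mulr_sumr !polyCD !polyCM.
have goodXn mon : good 'X_[mon].
  rewrite mpolyXE_id; apply: (big_ind good (goodC 1) goodM) => i _.
  elim: (mon i) => [|e IHe]; first exact: (goodC 1).
  by rewrite exprS; exact: (goodM _ _ (goodX i) IHe).
suff: good g by [].
rewrite [g]mpolyE; apply: (big_ind good _ goodD) => [|mon _].
  by rewrite -mpolyC0; apply: goodC.
by rewrite -mul_mpolyC; apply: goodM.
Qed.

(** * Linear systems modulo eps^2 *)

Lemma dvdp_sum (F : fieldType) (I : finType) (p : {poly F}) (f : I -> {poly F}) :
  (forall i, p %| f i) -> p %| \sum_i f i.
Proof.
move=> p_dvd; apply: (big_ind (fun q => p %| q) (dvdp0 p)) => [q1 q2|i _] //.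
exact: dvdp_add.
Qed.

Lemma dvdp_mx (F : fieldType) (m n : nat) (p : {poly F})
    (A : 'M[{poly F}]_(m, n)) :
  (forall i j, p %| A i j) -> exists E, A = p *: E.
Proof.
move=> p_dvd; exists (\matrix_(i, j) (A i j %/ p)).
by apply/matrixP => i j; rewrite !mxE mulrC divpK.
Qed.

(** As [\adj T *m r] is [\det T] times the solution [v] of [T v = r], this is [V v = y] modulo
    eps^2, cleared of denominators. *)
Lemma cramer_mod_X2 (F : fieldType) (k : nat) (T U V E : 'M[{poly F}]_k)
    (r y g : 'cV[{poly F}]_k) :
  T - U *m V = 'X^2 *: E -> r - U *m y = 'X^2 *: g -> (\det T).[0] != 0 ->
  forall s, 'X^2 %| \det T * y s 0 - (V *m (\adj T *m r)) s 0.
Proof.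
move=> TE rE detT0 s.
pose e := \det T *: y - V *m (\adj T *m r).
(* At eps = 0 the error term dies and [\det T] becomes [\det U * \det V]. *)
have detU0 : (\det U).[0] != 0.
  apply: contraNneq detT0 => detU0.
  have X2_at0 : horner_eval 0 ('X^2 : {poly F}) = 0.
    by rewrite /horner_eval hornerXn expr0n.
  rewrite -/(horner_eval 0 (\det T)) -det_map_mx -(subrK (U *m V) T) TE.
  rewrite map_mxD map_mxM map_mxZ /=.
  rewrite X2_at0 scale0r add0r det_mulmx !det_map_mx /=.
  by rewrite [horner_eval 0 (\det U)]detU0 mul0r.
have Ue : U *m e = 'X^2 *: (E *m (\adj T *m r) - \det T *: g).
  have UyE : U *m y = r - 'X^2 *: g by rewrite -rE subKr.
  have UVE : U *m V = T - 'X^2 *: E by rewrite -TE subKr.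
  have Tadj : T *m (\adj T *m r) = \det T *: r.
    by rewrite mulmxA mul_mx_adj mul_scalar_mx.
  rewrite mulmxBr -scalemxAr UyE mulmxA UVE mulmxBl Tadj -scalemxAl !scalerBr.
  rewrite opprB addrC subrKA; congr (_ - _).
  by rewrite !scalerA mulrC.
have {Ue} : \det U *: e = 'X^2 *: (\adj U *m (E *m (\adj T *m r) - \det T *: g)).
  by rewrite scalemxAr -Ue mulmxA mul_adj_mx mul_scalar_mx.
move/matrixP/(_ s 0); rewrite !mxE => detU_e.
(* [\det U] has nonzero constant term, so it can be cancelled modulo ['X^2]. *)
have X2_coprime : coprimep 'X^2 (\det U).
  by rewrite coprimep_expl // coprimep_sym coprimepX.
by rewrite -(Gauss_dvdpr _ X2_coprime) detU_e dvdp_mulr ?dvdpp.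
Qed.

(** * Traces modulo eps^2 *)

(* Moving a cluster by [delta * eps] has a first-order effect on [g] that is
   linear in [delta], so only the barycentre of each cluster matters. *)
Lemma Tr_mod_X2 (R : realType) (m k : nat) (ns : 'I_k -> nat)
    (z : 'I_k -> 'I_m -> R[i]) (delta : forall s : 'I_k, 'I_(ns s) -> 'I_m -> R[i])
    (g : {mpoly R[i][m]}) : (forall s, 0 < ns s)%N ->
  'X^2 %| Tr z delta g
          - \sum_s (ns s)%:R * (map_mpoly polyC g).@[cluster_center z delta s].
Proof.
move=> ns_gt0; rewrite /Tr -sumrB; apply: dvdp_sum => s.
have [c [G expand]] := first_order_expansion g (z s).
pose mean i := (\sum_(r < ns s) delta s r i) / (ns s)%:R.
pose lin (d : 'I_m -> R[i]) := c%:P + (\sum_i G i * d i)%:P * 'X.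
(* An affine function sums over a cluster to [ns s] times its value at the mean; dividing by [ns s]
   uses characteristic 0. *)
have sum_lin : \sum_(t < ns s) lin (delta s t) = (ns s)%:R * lin mean.
  rewrite big_split /= sumr_const card_ord -mulr_suml -rmorph_sum /= mulrDr.
  rewrite mulr_natl; congr (_ + _).
  rewrite mulrA -polyC_natr -polyCM; congr (_%:P * _).
  rewrite exchange_big mulr_sumr; apply: eq_bigr => i _.
  by rewrite -mulr_sumr [RHS]mulrCA [_%:R * _]mulrC divfK // pnatr_eq0 -lt0n.
have := dvdp_sub (dvdp_sum (fun t => expand (delta s t)))
  (dvdp_mull (ns s)%:R (expand mean)).
by rewrite sumrB sum_lin mulrBr opprB addrA subrK.
Qed.

(** * Coefficients and values over C(eps) *)

Lemma meval_map_mpoly (m : nat) (A S : comNzRingType) (f : {rmorphism A -> S})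
    (g : {mpoly A[m]}) (x : 'I_m -> A) :
  (map_mpoly f g).@[fun i => f (x i)] = f g.@[x].
Proof.
rewrite /map_mpoly /mmap raddf_sum mevalE raddf_sum; apply: eq_bigr => mon _ /=.
rewrite mmap1_id mevalM mevalC mevalX rmorphM rmorph_prod.
by congr (_ * _); apply: eq_bigr => i _; rewrite rmorphXn.
Qed.

Lemma mcoeff_mpoly_frac (R : realType) (m : nat) (g : {mpoly R[i][m]}) mon :
  (mpoly_frac g)@_mon = tofrac (g@_mon)%:P.
Proof. exact: mcoeff_map_mpoly. Qed.

Lemma meval_mpoly_frac (R : realType) (m : nat) (g : {mpoly R[i][m]})
    (x : 'I_m -> epspoly R) :
  (mpoly_frac g).@[fun i => tofrac (x i)] = tofrac (map_mpoly polyC g).@[x].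
Proof.
have -> : mpoly_frac g = map_mpoly (@tofrac _) (map_mpoly polyC g).
  apply/mpolyP => mon; apply: etrans (mcoeff_mpoly_frac g mon) _.
  have /= -> := mcoeff_map_mpoly (@tofrac (epspoly R)) mon (map_mpoly polyC g).
  by congr tofrac; apply: esym (mcoeff_map_mpoly _ _ _).
exact: (meval_map_mpoly (@tofrac (epspoly R))).
Qed.

(** Puts every coefficient and value of a generator over the single denominator [d], the form from
    which Taylor expansions are read off; [d] will be the determinant of the trace block. *)
Lemma frac_combination (R : realType) (m k : nat) (g : {mpoly R[i][m]})
    (c : 'I_k -> {mpoly R[i][m]}) (v : 'I_k -> epsfrac R) (p : 'I_k -> epspoly R)
    (d : epspoly R) :
  d != 0 -> (forall s, tofrac d * v s = tofrac (p s)) ->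
  let f := mpoly_frac g - \sum_s v s *: mpoly_frac (c s) in
  (forall mon, f@_mon =
     tofrac (d * (g@_mon)%:P - \sum_s p s * ((c s)@_mon)%:P) / tofrac d) /\
  (forall x : 'I_m -> epspoly R, f.@[fun i => tofrac (x i)] =
     tofrac (d * (map_mpoly polyC g).@[x]
             - \sum_s p s * (map_mpoly polyC (c s)).@[x]) / tofrac d).
Proof.
move=> d0 dv f.
have tofrac_d0 : tofrac d != 0 by rewrite tofrac_eq0.
split=> [mon|x]; apply: (canRL (mulfK tofrac_d0)).
- rewrite mcoeffB mulrBl tofracB tofracM mcoeff_mpoly_frac mulrC; congr (_ - _).
  rewrite [X in X * _]raddf_sum mulr_suml [RHS]rmorph_sum; apply: eq_bigr => s _.
  by rewrite /= tofracM -dv mcoeffZ mcoeff_mpoly_frac mulrAC [tofrac d * _]mulrC.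
- rewrite mevalB mulrBl tofracB tofracM meval_mpoly_frac mulrC; congr (_ - _).
  rewrite [X in X * _]raddf_sum mulr_suml [RHS]rmorph_sum; apply: eq_bigr => s _.
  by rewrite /= tofracM -dv mevalZ meval_mpoly_frac mulrAC [tofrac d * _]mulrC.
Qed.

Theorem proposition7p5 (R : realType) (m k n : nat)
  (b : 'I_n -> {mpoly R[i][m]})
  (z : 'I_k -> 'I_m -> R[i])
  (ns : 'I_k -> nat) (ns_gt0 : forall s : 'I_k, (0 < ns s)%N)
  (sum_ns : (\sum_(s < k) ns s)%N = n)
  (delta : forall s : 'I_k, 'I_(ns s) -> 'I_m -> R[i])
  (delta_lt1 : forall (s : 'I_k) (t : 'I_(ns s)) (i : 'I_m),
      `|delta s t i| < 1)
  (sigma : 'S_n) (R_k : 'M[epsfrac R]_n)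
  (gecp_sigma :
    gecp (map_mx (@tofrac _) (trace_mx z delta b)) k sigma 1%g R_k)
  (rank_PR0 :
    \rank (map_mx (horner_eval 0) (perm_mx sigma *m trace_mx z delta b)) = k)
  (regular_PR0 :
    regular_mx (map_mx (horner_eval 0) (perm_mx sigma *m trace_mx z delta b)))
  (v : 'I_m -> 'I_k -> 'cV[epsfrac R]_k)
  (v_sol : forall (i : 'I_m) (j : 'I_k),
    map_mx (@tofrac _)
      (trace_mx_k z delta b (leq_clusters ns_gt0 sum_ns) sigma) *m v i j =
    map_mx (@tofrac _)
      (rhs_vec z delta b (leq_clusters ns_gt0 sum_ns) sigma i j)) :
  forall (i : 'I_m) (j s : 'I_k),
    vanishes_mod_eps2
      (radical_gen b (leq_clusters ns_gt0 sum_ns) v i j)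
      (cluster_center z delta s).
Proof.
set w := widen_ord (leq_clusters ns_gt0 sum_ns).
move=> i j s.
set T := trace_mx_k z delta b (leq_clusters ns_gt0 sum_ns) sigma in v_sol.
set r := rhs_vec z delta b (leq_clusters ns_gt0 sum_ns) sigma i j.
pose ev g s := (map_mpoly polyC g).@[cluster_center z delta s].
have evM g h s' : ev (g * h) s' = ev g s' * ev h s' by rewrite /ev rmorphM mevalM.
(* [T] at eps = 0 is the leading block of a regular matrix of rank [k]. *)
have detT0 : (\det T).[0] != 0.
  rewrite -/(horner_eval 0 (\det T)) -det_map_mx -unitfE -unitmxE.
  have := regular_leading_unitmx (leq_clusters ns_gt0 sum_ns) rank_PR0 regular_PR0.
  set M := mxsub _ _ _; suff -> : M = map_mx (horner_eval 0) T by [].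
  by apply/matrixP => a c; rewrite !mxE.
(* The weights [ns s] go into [U], so [V] and [y] hold plain values at the centres. *)
pose U : 'M[epspoly R]_k := \matrix_(a, s) ((ns s)%:R * ev (b (sigma (w a))) s).
pose V : 'M[epspoly R]_k := \matrix_(s, a) ev (b (w a)) s.
pose y : 'cV[epspoly R]_k := \col_s ev ('X_i * b (w j)) s.
have [E TE] : exists E, T - U *m V = 'X^2 *: E.
  apply: dvdp_mx => a c; rewrite mxE [T a c]mxE -row_permE !mxE.
  have := Tr_mod_X2 z delta (b (sigma (w a)) * b (w c)) ns_gt0.
  congr (_ %| _ - _); apply: eq_bigr => s' _.
  by rewrite !mxE -[RHS]mulrA -evM.
have [g rE] : exists g, r - U *m y = 'X^2 *: g.
  apply: dvdp_mx => a c; rewrite !mxE.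
  have := Tr_mod_X2 z delta ('X_i * b (w j) * b (sigma (w a))) ns_gt0.
  congr (_ %| _ - _); apply: eq_bigr => s' _.
  by rewrite !mxE -[RHS]mulrA -evM [b _ * _]mulrC.
have X2_dvd := cramer_mod_X2 TE rE detT0 s.
have detT_neq0 : \det T != 0 by apply: contraNneq detT0 => ->; rewrite horner0.
have cramer a : tofrac (\det T) * v i j a 0 = tofrac ((\adj T *m r) a 0).
  have /(congr1 (mulmx (\adj (map_mx (@tofrac _) T)))) := v_sol i j.
  rewrite mulmxA mul_adj_mx mul_scalar_mx -map_mx_adj -map_mxM det_map_mx.
  by move/matrixP/(_ a 0); rewrite !mxE.
(* The product with ['X_i] moves inside [mpoly_frac], so that the generator has the shape treated by
   [frac_combination]. *)
have -> : radical_gen b (leq_clusters ns_gt0 sum_ns) v i j =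
    mpoly_frac ('X_i * b (w j)) - \sum_a v i j a 0 *: mpoly_frac (b (w a)).
  rewrite /radical_gen; congr (_ - _); rewrite /mpoly_frac [RHS]rmorphM.
  by congr (_ * _); apply: esym (map_mpolyX _ _).
have [coef value] := frac_combination ('X_i * b (w j)) (fun a => b (w a))
  detT_neq0 cramer.
split=> [mon|]; first by rewrite coef; apply: taylor_tofrac_div.
rewrite value; apply: taylor_tofrac_div_X2 => //.
move: X2_dvd; congr (_ %| _ - _); first by rewrite mxE.
by rewrite mxE; apply: eq_bigr => a _; rewrite mxE mulrC.
Qed.
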